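(* Let $k$ be a field or commutative ring, let $R\in M_n(k)\otimes M_n(k)$ be a solution of the Quantum Yang-Baxter Equations, and let $\lambda\in k$ be a fixed invertible constant. Let $A(R)$ be the quantum matrix algebra with generators $t^i{}_j$, let $V(R_{21})$ be the algebra of quantum vectors of type $R_{21}$ with generators $v^i$, and let $V^*(R)$ be the algebra of quantum covectors of type $R$ with generators $x_i$ (both formed with the same $\lambda$). Then the assignment $t^i{}_j\mapsto v^i x_j:=v^i\otimes x_j$ is a realization of $A(R)$ in the ordinary tensor product algebra $V(R_{21})\otimes V^*(R)$, i.e. it extends to an algebra homomorphism $A(R)\to V(R_{21})\otimes V^*(R)$.
   Context: Algebras are unital and associative over $k$; repeated indices are summed over $1,\dots,n$. $R$ has components $R^i{}_j{}^k{}_l$, where $(i,j)$ are the row and column indices in the first copy of $M_n$ and $(k,l)$ those in the second. $R_{21}$ is the transposed matrix $(R_{21})^i{}_j{}^k{}_l=R^k{}_l{}^i{}_j$. The Quantum Yang-Baxter Equations are $R_{12}R_{13}R_{23}=R_{23}R_{13}R_{12}$ in $M_n^{\otimes 3}$. $A(R)$: the algebra with $n^2$ generators $t^i{}_j$ and $1$, and relations $R^i{}_a{}^k{}_b\,t^a{}_j t^b{}_l=t^k{}_b t^i{}_a R^a{}_j{}^b{}_l$ (in short $R\mathbf t_1\mathbf t_2=\mathbf t_2\mathbf t_1R$). $V^*(R)$: the algebra with $n$ generators $x_i$ and $1$, and relations $x_ix_k=\lambda\, x_nx_m R^m{}_i{}^n{}_k$. For any $R$, $V(R)$: the algebra with $n$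 generators $v^i$ and $1$, and relations $v^iv^k=\lambda R^i{}_j{}^k{}_l\, v^lv^j$. Thus $V(R_{21})$ has relations $v^iv^k=\lambda R^k{}_l{}^i{}_j v^lv^j$. In the ordinary tensor product algebra the generators $v^i=v^i\otimes 1$ and $x_j=1\otimes x_j$ commute. *)

(* Defs.v *)
From HB Require Import structures.
From mathcomp Require Import all_boot all_algebra.
From mathcomp Require Import finmap.
From mathcomp Require Import boolp.
From mathcomp.multinomials Require Import monalg.

Set Implicit Arguments.
Unset Strict Implicit.
Unset Printing Implicit Defensive.

Import GRing.Theory.

Local Open Scope ring_scope.
Local Open Scope quotient_scope.

Record ideal (k : comNzRingType) (F : lalgType k) := Ideal {
  ideal_mem :> F -> Prop;
  ideal0 : ideal_mem 0;
  idealD : forall x y, ideal_mem x -> ideal_mem y -> ideal_mem (x + y);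
  idealZ : forall c x, ideal_mem x -> ideal_mem (c *: x);
  idealMl : forall y x, ideal_mem x -> ideal_mem (y * x);
  idealMr : forall y x, ideal_mem x -> ideal_mem (x * y)
}.

Section Quotient.
Variables (k : comNzRingType) (F : lalgType k) (I : ideal F).

Lemma idealN x : I x -> I (- x).
Proof. by move=> Ix; rewrite -scaleN1r; apply: idealZ. Qed.

Definition ideal_eq (x y : F) : bool := `[< I (x - y) >].

Lemma ideal_eq_equiv : equiv_class_of ideal_eq.
Proof.
split=> [x|x y|y x z].
- by apply/asboolP; rewrite subrr; apply: ideal0.
- by apply/asboolP/asboolP => /idealN; rewrite opprB.
- move=> /asboolP Ixy /asboolP Iyz; apply/asboolP.
  by rewrite -(subrKA y); apply: idealD.
Qed.

Canonical ideal_equiv := EquivRelPack ideal_eq_equiv.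

Definition quot_alg : Type := {eq_quot ideal_equiv}.

HB.instance Definition _ := Choice.on quot_alg.
HB.instance Definition _ := EqQuotient.on quot_alg.

Lemma quot_ind (P : quot_alg -> Prop) :
  (forall x, P (\pi_quot_alg x)) -> forall a, P a.
Proof. by move=> Ppi a; rewrite -[a]reprK. Qed.

Lemma ideal_quot_eq (x y : F) : I (x - y) -> \pi_quot_alg x = \pi_quot_alg y.
Proof. by move=> Ixy; apply/eqmodP/asboolP. Qed.

Lemma quot_reprP (x : F) : I (repr (\pi_quot_alg x) - x).
Proof.
by have /eqmodP/asboolP: repr (\pi_quot_alg x) = x %[mod quot_alg]
  by rewrite reprK.
Qed.

Definition quot_zero : quot_alg := \pi_quot_alg 0.
Definition quot_one : quot_alg := \pi_quot_alg 1.
Definition quot_opp (a : quot_alg) : quot_alg := \pi_quot_alg (- repr a).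
Definition quot_add (a b : quot_alg) : quot_alg :=
  \pi_quot_alg (repr a + repr b).
Definition quot_mul (a b : quot_alg) : quot_alg :=
  \pi_quot_alg (repr a * repr b).
Definition quot_scale (c : k) (a : quot_alg) : quot_alg :=
  \pi_quot_alg (c *: repr a).

Lemma quot_oppE x : quot_opp (\pi_quot_alg x) = \pi_quot_alg (- x).
Proof. by apply: ideal_quot_eq; rewrite -opprD; apply/idealN/quot_reprP. Qed.

Lemma quot_addE x y : quot_add (\pi_quot_alg x) (\pi_quot_alg y) =
  \pi_quot_alg (x + y).
Proof.
apply: ideal_quot_eq; rewrite opprD addrACA.
by apply: idealD; apply: quot_reprP.
Qed.

Lemma quot_mulE x y : quot_mul (\pi_quot_alg x) (\pi_quot_alg y) =
  \pi_quot_alg (x * y).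
Proof.
apply: ideal_quot_eq.
rewrite -(subrKA (x * repr (\pi_quot_alg y))) -mulrBl -mulrBr.
by apply: idealD; [apply: idealMr|apply: idealMl]; apply: quot_reprP.
Qed.

Lemma quot_scaleE c x : quot_scale c (\pi_quot_alg x) = \pi_quot_alg (c *: x).
Proof. by apply: ideal_quot_eq; rewrite -scalerBr; apply/idealZ/quot_reprP. Qed.

Let quotE := (quot_oppE, quot_addE, quot_mulE, quot_scaleE).

Lemma quot_addA : associative quot_add.
Proof.
elim/quot_ind=> x; elim/quot_ind=> y; elim/quot_ind=> z.
by rewrite !quotE addrA.
Qed.
Lemma quot_addC : commutative quot_add.
Proof. by elim/quot_ind=> x; elim/quot_ind=> y; rewrite !quotE addrC. Qed.
Lemma quot_add0 : left_id quot_zero quot_add.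
Proof. by elim/quot_ind=> x; rewrite !quotE add0r. Qed.
Lemma quot_addN : left_inverse quot_zero quot_opp quot_add.
Proof. by elim/quot_ind=> x; rewrite !quotE addNr. Qed.

HB.instance Definition _ := GRing.isZmodule.Build quot_alg
  quot_addA quot_addC quot_add0 quot_addN.

Lemma quot_mulA : associative quot_mul.
Proof.
elim/quot_ind=> x; elim/quot_ind=> y; elim/quot_ind=> z.
by rewrite !quotE mulrA.
Qed.
Lemma quot_mul1r : left_id quot_one quot_mul.
Proof. by elim/quot_ind=> x; rewrite !quotE mul1r. Qed.
Lemma quot_mulr1 : right_id quot_one quot_mul.
Proof. by elim/quot_ind=> x; rewrite !quotE mulr1. Qed.
Lemma quot_mulDl : left_distributive quot_mul +%R.
Proof.
elim/quot_ind=> x; elim/quot_ind=> y; elim/quot_ind=> z.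
by rewrite /GRing.add /= !quotE mulrDl.
Qed.
Lemma quot_mulDr : right_distributive quot_mul +%R.
Proof.
elim/quot_ind=> x; elim/quot_ind=> y; elim/quot_ind=> z.
by rewrite /GRing.add /= !quotE mulrDr.
Qed.

HB.instance Definition _ := GRing.Zmodule_isPzRing.Build quot_alg
  quot_mulA quot_mul1r quot_mulr1 quot_mulDl quot_mulDr.

Lemma quot_scaleA c d a : quot_scale c (quot_scale d a) = quot_scale (c * d) a.
Proof. by elim/quot_ind: a => x; rewrite !quotE scalerA. Qed.
Lemma quot_scale1 : left_id 1 quot_scale.
Proof. by elim/quot_ind=> x; rewrite !quotE scale1r. Qed.
Lemma quot_scaleDr : right_distributive quot_scale +%R.
Proof.
move=> c; elim/quot_ind=> x; elim/quot_ind=> y.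
by rewrite /GRing.add /= !quotE scalerDr.
Qed.
Lemma quot_scaleDl a : {morph quot_scale^~ a : c d / c + d}.
Proof.
move=> c d; elim/quot_ind: a => x.
by rewrite [in RHS]/GRing.add /= !quotE scalerDl.
Qed.

HB.instance Definition _ := GRing.Zmodule_isLmodule.Build k quot_alg
  quot_scaleA quot_scale1 quot_scaleDr quot_scaleDl.

Lemma quot_scaleAl (c : k) (a b : quot_alg) : c *: (a * b) = (c *: a) * b.
Proof.
elim/quot_ind: a => x; elim/quot_ind: b => y.
by rewrite /GRing.mul /GRing.scale /= !quotE scalerAl.
Qed.

Lemma quot_scaleAr :
    (forall (c : k) (u v : F), c *: (u * v) = u * (c *: v)) ->
  forall (c : k) (a b : quot_alg), c *: (a * b) = a * (c *: b).
Proof.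
move=> scalerAr c a b; elim/quot_ind: a => x; elim/quot_ind: b => y.
by rewrite /GRing.mul /GRing.scale /= !quotE scalerAr.
Qed.

End Quotient.

Inductive ideal_gen (k : comNzRingType) (F : lalgType k) (G : F -> Prop) :
    F -> Prop :=
| ideal_gen_base x : G x -> ideal_gen G x
| ideal_gen0 : ideal_gen G 0
| ideal_genD x y : ideal_gen G x -> ideal_gen G y -> ideal_gen G (x + y)
| ideal_genZ c x : ideal_gen G x -> ideal_gen G (c *: x)
| ideal_genMl y x : ideal_gen G x -> ideal_gen G (y * x)
| ideal_genMr y x : ideal_gen G x -> ideal_gen G (x * y).

Definition generated_ideal (k : comNzRingType) (F : lalgType k)
    (G : F -> Prop) : ideal F :=
  Ideal (ideal_gen0 G) (@ideal_genD _ _ G) (@ideal_genZ _ _ G)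
    (@ideal_genMl _ _ G) (@ideal_genMr _ _ G).

(* k<X>: the monoid algebra of the free monoid on X *)
Notation free_alg k X := {malg k[{fmonom X}]}.

Definition fgen (k : comNzRingType) (X : choiceType) (x : X) : free_alg k X :=
  << fmu x >>.

(* MathComp's algType requires 1 != 0.  The condition [rels_const], that both
   sides of every relation have the same constant term, makes the algebra
   presented by these relations nonzero. *)
Record relations (k : comNzRingType) (X : choiceType) := Relations {
  rels_hold :> free_alg k X -> free_alg k X -> Prop;
  rels_const : forall u v, rels_hold u v -> u@_(@mone _) = v@_(@mone _)
}.

Section Presented.
Variables (k : comNzRingType) (X : choiceType) (rel : relations k X).

Definition relation_ideal : ideal (free_alg k X) :=
  generated_ideal (fun w => exists u v, rel u v /\ w = u - v).

Definition presented : Type := quot_alg relation_ideal.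

HB.instance Definition _ := GRing.PzRing.on presented.
HB.instance Definition _ := GRing.Lmodule.on presented.

Definition pgen (x : X) : presented := \pi_(quot_alg relation_ideal) (fgen k x).

Lemma relation_ideal_const w : relation_ideal w -> w@_(@mone _) = 0.
Proof.
elim=> {w} [w [u [v [/rels_const e ->]]]||u v _ eu _ ev|c u _ eu|v u _ eu
  |v u _ eu].
- by rewrite mcoeffB e subrr.
- exact: mcoeff0.
- by rewrite mcoeffD eu ev addr0.
- by rewrite mcoeffZ eu mulr0.
- by rewrite rmorphM /= eu mulr0.
- by rewrite rmorphM /= eu mul0r.
Qed.

Lemma presented_oner_neq0 : (1 : presented) != 0.
Proof.
apply/eqP => /eqmodP/asboolP/relation_ideal_const.
by rewrite subr0 rmorph1; apply/eqP/oner_neq0.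
Qed.

HB.instance Definition _ :=
  GRing.PzSemiRing_isNonZero.Build presented presented_oner_neq0.

HB.instance Definition _ := GRing.Lmodule_isLalgebra.Build k presented
  (@quot_scaleAl _ _ relation_ideal).

Lemma malg_scalerAr (K : monomType) (c : k) (u v : {malg k[K]}) :
  c *: (u * v) = u * (c *: v).
Proof.
apply/malgP=> m; rewrite mcoeffZ.
rewrite (mcoeffMlw _ (fsubset_refl (msupp u)) (fsubset_refl (msupp v))).
rewrite (mcoeffMlw _ (fsubset_refl (msupp u)) (msuppZ_le c v)).
rewrite mulr_sumr; apply: eq_bigr => p _.
rewrite mulr_sumr; apply: eq_bigr => q _.
by rewrite mcoeffZ mulrnAr mulrCA.
Qed.

HB.instance Definition _ := GRing.Lalgebra_isAlgebra.Build k presented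
  (@quot_scaleAr _ _ relation_ideal (@malg_scalerAr _)).

End Presented.

Section LinearExtension.
Variables (k : comNzRingType) (K : choiceType) (M : lmodType k).
Implicit Types (g : K -> M) (u v : {malg k[K]}).

Definition lin_ext g u : M := \sum_(p <- msupp u) u@_p *: g p.

Lemma lin_extEw g u (d : {fset K}) : (msupp u `<=` d)%fset ->
  lin_ext g u = \sum_(p <- d) u@_p *: g p.
Proof.
move=> le; rewrite [LHS](big_fset_incl _ le) => //= x xd /mcoeff_outdom ->.
by rewrite scale0r.
Qed.

Lemma lin_extU g p : lin_ext g << p >> = g p.
Proof. by rewrite (lin_extEw _ msuppU_le) big_seq_fset1 mcoeffUU scale1r. Qed.

Lemma lin_extD g u v : lin_ext g (u + v) = lin_ext g u + lin_ext g v.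
Proof.
pose d := (msupp u `|` msupp v)%fset.
rewrite (lin_extEw g (msuppD_le u v)) (lin_extEw g (fsubsetUl _ (msupp v))).
rewrite (lin_extEw g (fsubsetUr (msupp u) _)) -big_split /=.
by apply: eq_bigr => p _; rewrite mcoeffD scalerDl.
Qed.

Lemma lin_extZ g c u : lin_ext g (c *: u) = c *: lin_ext g u.
Proof.
rewrite (lin_extEw g (msuppZ_le c u)) scaler_sumr.
by apply: eq_bigr => p _; rewrite mcoeffZ scalerA.
Qed.

Lemma lin_ext0 g : lin_ext g 0 = 0.
Proof. by rewrite -(scale0r 0) lin_extZ scale0r. Qed.

Lemma lin_extDf g h u : lin_ext (fun p => g p + h p) u =
  lin_ext g u + lin_ext h u.
Proof. by rewrite -big_split; apply: eq_bigr => p _; rewrite scalerDr. Qed.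

Lemma lin_extZf c g u : lin_ext (fun p => c *: g p) u = c *: lin_ext g u.
Proof.
by rewrite scaler_sumr; apply: eq_bigr => p _; rewrite !scalerA mulrC.
Qed.

Lemma lin_ext0f u : lin_ext (fun=> 0) u = 0.
Proof. by rewrite /lin_ext big1 // => p _; rewrite scaler0. Qed.

Lemma eq_lin_ext g h u : g =1 h -> lin_ext g u = lin_ext h u.
Proof. by move=> e; apply: eq_bigr => p _; rewrite e. Qed.

Lemma malg_ind (P : {malg k[K]} -> Prop) :
    P 0 -> (forall u v, P u -> P v -> P (u + v)) ->
    (forall c u, P u -> P (c *: u)) -> (forall p, P << p >>) ->
  forall u, P u.
Proof.
move=> P0 PD PZ PU u; rewrite (monalgE u); elim/big_ind: _ => // p _.
suff -> : << u@_p *g p >> = u@_p *: << p >> by apply/PZ/PU.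
by apply/malgP=> q; rewrite mcoeffZ !mcoeffU mulrnAr mulr1.
Qed.

End LinearExtension.

Section Tensor.
Variables (k : comNzRingType) (A B : algType k).

(* the free module on A x B, with the product
   (a, b) (a', b') = (a a', b b') on basis elements *)
Definition tfree : Type := {malg k[(A * B)%type]}.

HB.instance Definition _ := GRing.Lmodule.on tfree.

Definition tbase (a : A) (b : B) : tfree := << (a, b) >>.

Lemma tfree_ind (P : tfree -> Prop) :
    P 0 -> (forall u v, P u -> P v -> P (u + v)) ->
    (forall c u, P u -> P (c *: u)) -> (forall a b, P (tbase a b)) ->
  forall u, P u.
Proof. by move=> P0 PD PZ PU; apply: malg_ind => // -[a b]; apply: PU. Qed.

Definition tmul (u v : tfree) : tfree :=
  lin_ext (fun p => lin_ext (fun q => tbase (p.1 * q.1) (p.2 * q.2)) v) u.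

Lemma tmulUU a b a' b' :
  tmul (tbase a b) (tbase a' b') = tbase (a * a') (b * b').
Proof. by rewrite /tmul !lin_extU. Qed.
Lemma tmulDl : left_distributive tmul +%R.
Proof. by move=> u v w; apply: lin_extD. Qed.
Lemma tmulDr : right_distributive tmul +%R.
Proof.
move=> u v w; rewrite /tmul -lin_extDf.
by apply: eq_lin_ext => p; rewrite lin_extD.
Qed.
Lemma tmulZl c u v : tmul (c *: u) v = c *: tmul u v.
Proof. exact: lin_extZ. Qed.
Lemma tmulZr c u v : tmul u (c *: v) = c *: tmul u v.
Proof.
by rewrite /tmul -lin_extZf; apply: eq_lin_ext => p; rewrite lin_extZ.
Qed.
Lemma tmul0l u : tmul 0 u = 0. Proof. exact: lin_ext0. Qed.
Lemma tmul0r u : tmul u 0 = 0.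
Proof. by rewrite -[X in tmul _ X](scale0r 0) tmulZr scale0r. Qed.

#[local] Opaque tmul tbase.

Lemma tmulA : associative tmul.
Proof.
move=> u v w; move: u; apply: tfree_ind => [|x y ex ey|c x ex|a b].
- by rewrite !tmul0l.
- by rewrite !tmulDl ex ey.
- by rewrite !tmulZl ex.
move: v; apply: tfree_ind => [|x y ex ey|c x ex|a' b'].
- by rewrite !(tmul0l, tmul0r).
- by rewrite !(tmulDl, tmulDr) ex ey.
- by rewrite !(tmulZl, tmulZr) ex.
move: w; apply: tfree_ind => [|x y ex ey|c x ex|a'' b''].
- by rewrite !tmul0r.
- apply: etrans (congr1 (tmul _) (tmulDr _ x y)) _.
  apply: etrans (tmulDr _ _ _) _; apply: etrans _ (esym (tmulDr _ x y)).
  exact: (congr2 (fun s t : tfree => s + t) ex ey).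
- by rewrite !tmulZr ex.
by rewrite !tmulUU !mulrA.
Qed.
Lemma tmul1l : left_id (tbase 1 1) tmul.
Proof.
apply: tfree_ind => [|x y ex ey|c x ex|a b].
- by rewrite tmul0r.
- by rewrite tmulDr ex ey.
- by rewrite tmulZr ex.
by rewrite tmulUU !mul1r.
Qed.
Lemma tmul1r : right_id (tbase 1 1) tmul.
Proof.
apply: tfree_ind => [|x y ex ey|c x ex|a b].
- by rewrite tmul0l.
- by rewrite tmulDl ex ey.
- by rewrite tmulZl ex.
by rewrite tmulUU !mulr1.
Qed.

Lemma tfree_oner_neq0 : tbase 1 1 != 0.
Proof. by rewrite monalgU_eq0 oner_neq0. Qed.

HB.instance Definition _ := GRing.Zmodule_isNzRing.Build tfree
  tmulA tmul1l tmul1r tmulDl tmulDr tfree_oner_neq0.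
HB.instance Definition _ := GRing.Lmodule_isLalgebra.Build k tfree
  (fun c u v => esym (tmulZl c u v)).

Lemma tfree_scalerAr (c : k) (u v : tfree) : c *: (u * v) = u * (c *: v).
Proof. by rewrite -[RHS]/(tmul u (c *: v)) tmulZr. Qed.

(* the submodule of tfree whose quotient is the tensor product of modules *)
Inductive bilin_span : tfree -> Prop :=
| bilin_Dl a a' b : bilin_span (tbase (a + a') b - tbase a b - tbase a' b)
| bilin_Dr a b b' : bilin_span (tbase a (b + b') - tbase a b - tbase a b')
| bilin_Zl c a b : bilin_span (tbase (c *: a) b - c *: tbase a b)
| bilin_Zr c a b : bilin_span (tbase a (c *: b) - c *: tbase a b)
| bilin0 : bilin_span 0
| bilinD x y : bilin_span x -> bilin_span y -> bilin_span (x + y)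
| bilinZ c x : bilin_span x -> bilin_span (c *: x).

Lemma bilin_spanMl (y x : tfree) : bilin_span x -> bilin_span (y * x).
Proof.
move=> Hx; move: y; apply: tfree_ind => [|u v|c u|a0 b0].
- by rewrite mul0r; apply: bilin0.
- by rewrite mulrDl; apply: bilinD.
- by rewrite -scalerAl; apply: bilinZ.
elim: Hx => [a a' b|a b b'|c a b|c a b||u v _ Hu _ Hv|c u _ Hu];
  rewrite ?(mulrBr, mulrDr, mulr0) -?tfree_scalerAr.
- by rewrite /GRing.mul /= !tmulUU mulrDr; apply: bilin_Dl.
- by rewrite /GRing.mul /= !tmulUU mulrDr; apply: bilin_Dr.
- by rewrite /GRing.mul /= !tmulUU -scalerAr; apply: bilin_Zl.
- by rewrite /GRing.mul /= !tmulUU -scalerAr; apply: bilin_Zr.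
- exact: bilin0.
- exact: bilinD.
- exact: bilinZ.
Qed.

Lemma bilin_spanMr (y x : tfree) : bilin_span x -> bilin_span (x * y).
Proof.
move=> Hx; move: y; apply: tfree_ind => [|u v|c u|a0 b0].
- by rewrite mulr0; apply: bilin0.
- by rewrite mulrDr; apply: bilinD.
- by rewrite -tfree_scalerAr; apply: bilinZ.
elim: Hx => [a a' b|a b b'|c a b|c a b||u v _ Hu _ Hv|c u _ Hu];
  rewrite ?(mulrBl, mulrDl, mul0r) -?scalerAl.
- by rewrite /GRing.mul /= !tmulUU mulrDl; apply: bilin_Dl.
- by rewrite /GRing.mul /= !tmulUU mulrDl; apply: bilin_Dr.
- by rewrite /GRing.mul /= !tmulUU -scalerAl; apply: bilin_Zl.
- by rewrite /GRing.mul /= !tmulUU -scalerAl; apply: bilin_Zr.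
- exact: bilin0.
- exact: bilinD.
- exact: bilinZ.
Qed.

Definition bilin_ideal : ideal tfree :=
  Ideal bilin0 bilinD bilinZ bilin_spanMl bilin_spanMr.

End Tensor.

Notation tensor A B := (quot_alg (bilin_ideal A B)).

Definition tens (k : comNzRingType) (A B : algType k) (a : A) (b : B) :
  tensor A B := \pi_(tensor A B) (tbase a b).

(* Elements of M_n (x) M_n and M_n (x) M_n (x) M_n in components:
   R i j m l is R^i_j^m_l, with (i, j) the row and column in the first factor
   and (m, l) those in the second. *)
Definition tensor2 (k : comNzRingType) (n : nat) :=
  'I_n -> 'I_n -> 'I_n -> 'I_n -> k.
Definition tensor3 (k : comNzRingType) (n : nat) :=
  'I_n -> 'I_n -> 'I_n -> 'I_n -> 'I_n -> 'I_n -> k.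

Section QuantumAlgebras.
Variables (k : comNzRingType) (n : nat).
Implicit Types (R : tensor2 k n) (S T : tensor3 k n).

Definition mul3 S T : tensor3 k n := fun i j m l p q =>
  \sum_a \sum_b \sum_c S i a m b p c * T a j b l c q.

Definition R12 R : tensor3 k n := fun i j m l p q => R i j m l * (p == q)%:R.
Definition R13 R : tensor3 k n := fun i j m l p q => R i j p q * (m == l)%:R.
Definition R23 R : tensor3 k n := fun i j m l p q => R m l p q * (i == j)%:R.

Definition QYBE R := forall i j m l p q,
  mul3 (mul3 (R12 R) (R13 R)) (R23 R) i j m l p q =
  mul3 (mul3 (R23 R) (R13 R)) (R12 R) i j m l p q.

Definition R21 R : tensor2 k n := fun i j m l => R m l i j.

Lemma mcoeff1_fgenM (X : choiceType) (x y : X) :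
  (fgen k x * fgen k y)@_(@mone _) = 0.
Proof.
rewrite rmorphM /= [in LHS]mcoeffU1.
by case: eqP => [/(congr1 (@fdeg X))|_]; rewrite ?mul0r // /fdeg fmuE fm1.
Qed.

Lemma mcoeff1_quad (X : choiceType) (c : 'I_n -> 'I_n -> k)
    (x y : 'I_n -> 'I_n -> X) :
  (\sum_a \sum_b c a b *: (fgen k (x a b) * fgen k (y a b)))@_(@mone _) = 0.
Proof.
rewrite raddf_sum big1 // => a _; rewrite raddf_sum big1 // => b _.
by rewrite /= mcoeffZ mcoeff1_fgenM mulr0.
Qed.

Local Notation t i j := (fgen k (i, j)).

Definition A_hold R (u v : free_alg k ('I_n * 'I_n)%type) :=
  exists i j m l : 'I_n,
  u = \sum_a \sum_b R i a m b *: (t a j * t b l) /\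
  v = \sum_a \sum_b R a j b l *: (t m b * t i a).

Local Notation x i := (fgen k i).

Definition V_hold R (lambda : k) (u v : free_alg k 'I_n) :=
  exists i m : 'I_n,
  u = x i * x m /\
  v = lambda *: \sum_j \sum_l R i j m l *: (x l * x j).

Definition Vdual_hold R (lambda : k) (u v : free_alg k 'I_n) :=
  exists i m : 'I_n,
  u = x i * x m /\
  v = lambda *: \sum_a \sum_b R a i b m *: (x b * x a).

Lemma A_const R u v : A_hold R u v -> u@_(@mone _) = v@_(@mone _).
Proof.
case=> i [j [m [l [-> ->]]]].
exact: etrans
  (mcoeff1_quad (fun a b => R i a m b) (fun a _ => (a, j)) (fun _ b => (b, l)))
  (esym (mcoeff1_quad (fun a b => R a j b l)
    (fun _ b => (m, b)) (fun a _ => (i, a)))).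
Qed.

Lemma V_const R lambda u v : V_hold R lambda u v -> u@_(@mone _) = v@_(@mone _).
Proof.
case=> i [m [-> ->]]; apply: etrans (mcoeff1_fgenM i m) _; apply: esym.
apply: etrans (mcoeffZ _ _ _) _.
by rewrite (mcoeff1_quad (fun j l => R i j m l) (fun _ l => l) (fun j _ => j))
  mulr0.
Qed.

Lemma Vdual_const R lambda u v :
  Vdual_hold R lambda u v -> u@_(@mone _) = v@_(@mone _).
Proof.
case=> i [m [-> ->]]; apply: etrans (mcoeff1_fgenM i m) _; apply: esym.
apply: etrans (mcoeffZ _ _ _) _.
by rewrite (mcoeff1_quad (fun a b => R a i b m) (fun _ b => b) (fun a _ => a))
  mulr0.
Qed.

Definition A_rel R := Relations (@A_const R).
Definition V_rel R lambda := Relations (@V_const R lambda).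
Definition Vdual_rel R lambda := Relations (@Vdual_const R lambda).

End QuantumAlgebras.

Notation A_alg R := (presented (A_rel R)).
Notation V_alg R lambda := (presented (V_rel R lambda)).
Notation Vdual_alg R lambda := (presented (Vdual_rel R lambda)).

Definition t_gen (k : comNzRingType) (n : nat) (R : tensor2 k n) (i j : 'I_n) :
  A_alg R := pgen (A_rel R) (i, j).
Definition v_gen (k : comNzRingType) (n : nat) (R : tensor2 k n) (lambda : k)
  (i : 'I_n) : V_alg R lambda := pgen (V_rel R lambda) i.
Definition x_gen (k : comNzRingType) (n : nat) (R : tensor2 k n) (lambda : k)
  (i : 'I_n) : Vdual_alg R lambda := pgen (Vdual_rel R lambda) i.

(* Main.v *)
(* Write S = sum R^i_a^k_b v^a v^b and T = sum R^a_j^b_l x_b x_a.  The defining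
   relations of the two algebras read v^k v^i = lambda S and
   x_j x_l = lambda T.  Both sides of R t_1 t_2 = t_2 t_1 R are thus mapped to
   the same element: S (x) x_j x_l = S (x) lambda T = lambda S (x) T
   = v^k v^i (x) T. *)
Require Import Defs.
From HB Require Import structures.
From mathcomp Require Import all_boot all_algebra finmap.
From mathcomp.multinomials Require Import monalg.

Set Implicit Arguments.
Unset Strict Implicit.

Import GRing.Theory.
Local Open Scope ring_scope.
Local Open Scope quotient_scope.

(** * The projection onto a quotient algebra *)

Section QuotientMorphism.
Variables (k : comNzRingType) (F : lalgType k) (I : ideal F).

(** A named function, so that linear and multiplicative structures can be attached to the
    projection. *)
Definition quot_pi (x : F) : quot_alg I := \pi_(quot_alg I) x.

Lemma quot_pi_linear : linear quot_pi.
Proof.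
by move=> c x y; rewrite /GRing.scale /GRing.add /= quot_scaleE quot_addE.
Qed.

Lemma quot_pi_monoid_morphism : monoid_morphism quot_pi.
Proof. by split=> // x y; rewrite [RHS]quot_mulE. Qed.

HB.instance Definition _ :=
  GRing.isLinear.Build k F (quot_alg I) _ quot_pi quot_pi_linear.
HB.instance Definition _ :=
  GRing.isMonoidMorphism.Build F (quot_alg I) quot_pi quot_pi_monoid_morphism.

End QuotientMorphism.

(** * Universal property of free and of presented algebras *)

Section FreeAlgebra.
Variables (k : comNzRingType) (X : choiceType).

Lemma malgUM (K : monomType) (p q : K) :
  << p >> * << q >> = << mmul p q >> :> {malg k[K]}.
Proof.
by rewrite (malgMEw msuppU_le msuppU_le) !big_seq_fset1 !mcoeffUU mulr1.
Qed.

(* Being possibly zero, a quotient algebra is not an [algType]; the centrality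
   of the scalars is passed as [scalerAr]. *)
Variables (F : lalgType k) (J : ideal F).
Hypothesis scalerAr : forall (c : k) (u v : F), c *: (u * v) = u * (c *: v).
Variable e : X -> quot_alg J.

(** The algebra morphism extending [e]: each word goes to the product of its letters' images, in
    order. *)
Definition free_eval (u : free_alg k X) : quot_alg J :=
  lin_ext (fun m : {fmonom X} => \prod_(x <- (m : seq X)) e x) u.

Lemma free_eval_monom (m : {fmonom X}) :
  free_eval << m >> = \prod_(x <- (m : seq X)) e x.
Proof. exact: lin_extU. Qed.

Lemma free_evalZ c u : free_eval (c *: u) = c *: free_eval u.
Proof. exact: lin_extZ. Qed.

Lemma free_eval_linear : linear free_eval.
Proof. by move=> c u v; rewrite /free_eval lin_extD lin_extZ. Qed.

HB.instance Definition _ := GRing.isLinear.Build k (free_alg k X) (quot_alg J)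
  _ free_eval free_eval_linear.

(** Bilinearity reduces multiplicativity to words, whose product is concatenation; [scalerAr] takes
    scalars out of the right factor. *)
Lemma free_eval_monoid_morphism : monoid_morphism free_eval.
Proof.
split=> [|u v]; first by rewrite free_eval_monom fm1 big_nil.
move: u; apply: malg_ind => [|u u' IHu IHu'|c u IHu|p].
- by rewrite mul0r linear0 mul0r.
- by rewrite mulrDl !linearD /= mulrDl -IHu -IHu'.
- rewrite [in RHS]free_evalZ -quot_scaleAl -IHu -(scalerAl c u v).
  exact: free_evalZ.
move: v; apply: malg_ind => [|v v' IHv IHv'|c v IHv|q].
- by rewrite mulr0 linear0 mulr0.
- by rewrite mulrDr !linearD /= mulrDr -IHv -IHv'.
- rewrite [in RHS]free_evalZ -(quot_scaleAr scalerAr) -IHv -malg_scalerAr.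
  exact: free_evalZ.
by rewrite malgUM !free_eval_monom fmM big_cat.
Qed.

HB.instance Definition _ := GRing.isMonoidMorphism.Build (free_alg k X)
  (quot_alg J) free_eval free_eval_monoid_morphism.

Lemma free_eval_gen x : free_eval (fgen k x) = e x.
Proof. by rewrite free_eval_monom fmU big_seq1. Qed.

Lemma free_eval_quad (I I' : finType) (c : I -> I' -> k) (p q : I -> I' -> X) :
  free_eval (\sum_a \sum_b c a b *: (fgen k (p a b) * fgen k (q a b))) =
  \sum_a \sum_b c a b *: (e (p a b) * e (q a b)).
Proof.
rewrite linear_sum; apply: eq_bigr => a _.
rewrite linear_sum; apply: eq_bigr => b _.
by rewrite linearZ /= rmorphM /= !free_eval_gen.
Qed.

Variable rel : relations k X.
Hypothesis rel_eval : forall u v, rel u v -> free_eval u = free_eval v.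

(** The kernel of an algebra morphism is a two-sided ideal, so it suffices that it contains the
    generators [u - v]. *)
Lemma free_eval_ideal w : relation_ideal rel w -> free_eval w = 0.
Proof.
elim=> {w} [w [u [v [/rel_eval e_uv ->]]]||u v _ eu _ ev|c u _ eu|v u _ eu
  |v u _ eu].
- by rewrite linearB /= e_uv subrr.
- exact: linear0.
- by rewrite linearD /= eu ev addr0.
- by rewrite linearZ /= eu scaler0.
- by rewrite rmorphM /= eu mulr0.
- by rewrite rmorphM /= eu mul0r.
Qed.

Definition presented_eval (a : presented rel) : quot_alg J :=
  free_eval (repr (a : quot_alg (relation_ideal rel))).

(** Independence of the representative: [repr] of the class of [u] differs from [u] by an element of
    the relation ideal, which evaluation kills. *)
Lemma presented_eval_pi u :
  presented_eval (quot_pi (relation_ideal rel) u) = free_eval u.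
Proof.
by apply/subr0_eq; rewrite -linearB; apply/free_eval_ideal/quot_reprP.
Qed.

Lemma presented_eval_linear : linear presented_eval.
Proof.
move=> c; elim/quot_ind=> u; elim/quot_ind=> v.
rewrite -!/(quot_pi _ _); have := linearP (quot_pi (relation_ideal rel)) c u v.
by move=> /= <-; rewrite !presented_eval_pi linearP.
Qed.

Lemma presented_eval_monoid_morphism : monoid_morphism presented_eval.
Proof.
split; first by apply: etrans (presented_eval_pi 1) _; rewrite rmorph1.
elim/quot_ind=> u; elim/quot_ind=> v; rewrite -!/(quot_pi _ _).
have := rmorphM (quot_pi (relation_ideal rel)) u v.
by move=> /= <-; rewrite !presented_eval_pi rmorphM.
Qed.

HB.instance Definition _ := GRing.isLinear.Build k (presented rel)
  (quot_alg J) _ presented_eval presented_eval_linear.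
HB.instance Definition _ := GRing.isMonoidMorphism.Build (presented rel)
  (quot_alg J) presented_eval presented_eval_monoid_morphism.

Lemma presented_lift : exists f : {lrmorphism presented rel -> quot_alg J},
  forall x, f (pgen rel x) = e x.
Proof.
exists presented_eval => x.
by rewrite -[RHS]free_eval_gen -presented_eval_pi.
Qed.

End FreeAlgebra.

Lemma presented_rel (k : comNzRingType) (X : choiceType) (rel : relations k X)
    (u v : free_alg k X) : rel u v ->
  quot_pi (relation_ideal rel) u = quot_pi (relation_ideal rel) v.
Proof. by move=> uv; apply/ideal_quot_eq/ideal_gen_base; exists u, v. Qed.

(** * Bilinearity and product of pure tensors *)

Section TensorProduct.
Variables (k : comNzRingType) (A B : algType k).
Implicit Types (a : A) (b : B).

Lemma tensM a b a' b' : tens a b * tens a' b' = tens (a * a') (b * b').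
Proof. by rewrite [LHS]quot_mulE [X in \pi X]tmulUU. Qed.

Lemma tensE a b : tens a b = quot_pi (bilin_ideal A B) (tbase a b).
Proof. by []. Qed.

Lemma tens_linearl b : linear (fun a => tens a b).
Proof.
have pi_eq0 w : bilin_span w -> quot_pi (bilin_ideal A B) w = 0.
  by move=> Iw; apply: ideal_quot_eq; rewrite subr0.
move=> c a a'; rewrite !tensE.
(* Additivity and homogeneity are generators of [bilin_span], hence hold after projection; chained,
   they give linearity. *)
have /eqP := pi_eq0 _ (bilin_Dl (c *: a) a' b).
have /eqP := pi_eq0 _ (bilin_Zl c a b).
by rewrite !linearB /= linearZ /= !subr_eq !add0r addrC => /eqP-> /eqP->.
Qed.

Lemma tens_linearr a : linear (@tens k A B a).
Proof.
have pi_eq0 w : bilin_span w -> quot_pi (bilin_ideal A B) w = 0.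
  by move=> Iw; apply: ideal_quot_eq; rewrite subr0.
move=> c b b'; rewrite !tensE.
have /eqP := pi_eq0 _ (bilin_Dr a (c *: b) b').
have /eqP := pi_eq0 _ (bilin_Zr c a b).
by rewrite !linearB /= linearZ /= !subr_eq !add0r addrC => /eqP-> /eqP->.
Qed.

(** Arguments swapped, so that linearity in the left factor can be attached to a partial
    application. *)
Definition tensl (b : B) (a : A) : tensor A B := tens a b.

HB.instance Definition _ b := GRing.isLinear.Build k A (tensor A B) _
  (tensl b) (tens_linearl b).
HB.instance Definition _ a := GRing.isLinear.Build k B (tensor A B) _
  (@tens k A B a) (tens_linearr a).

(** A scalar crosses the tensor sign; this is where the two algebras must share the same
    [lambda]. *)
Lemma tens_scale_swap c a a' b b' :
  a' = c *: a -> b' = c *: b -> tens a b' = tens a' b.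
Proof. by move=> -> ->; rewrite linearZ -/(tensl b _) linearZ. Qed.

End TensorProduct.

(** * Vector and covector relations, and the image of the relations of [A_alg R] *)

Section QuantumRelations.
Variables (k : comNzRingType) (n : nat) (R : tensor2 k n) (lambda : k).
Local Notation v := (v_gen (R21 R) lambda).
Local Notation x := (x_gen R lambda).

Lemma v_genM i m :
  v m * v i = lambda *: \sum_a \sum_b R i a m b *: (v a * v b).
Proof.
have rel_mi : V_rel (R21 R) lambda (fgen k m * fgen k i)
    (lambda *: \sum_j \sum_l R21 R m j i l *: (fgen k l * fgen k j)).
  by exists m, i.
have := presented_rel rel_mi; rewrite rmorphM /= => ->.
rewrite linearZ /= linear_sum exchange_big /=; congr (_ *: _).
apply: eq_bigr => j _; rewrite linear_sum; apply: eq_bigr => l _.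
by rewrite linearZ /= rmorphM.
Qed.

Lemma x_genM j l :
  x j * x l = lambda *: \sum_a \sum_b R a j b l *: (x b * x a).
Proof.
have rel_jl : Vdual_rel R lambda (fgen k j * fgen k l)
    (lambda *: \sum_a \sum_b R a j b l *: (fgen k b * fgen k a)).
  by exists j, l.
have := presented_rel rel_jl; rewrite rmorphM /= => ->.
rewrite linearZ /= linear_sum; congr (_ *: _).
apply: eq_bigr => a _; rewrite linear_sum; apply: eq_bigr => b _.
by rewrite linearZ /= rmorphM.
Qed.

Lemma tens_RTT i j m l :
  \sum_a \sum_b R i a m b *: (tens (v a) (x j) * tens (v b) (x l)) =
  \sum_a \sum_b R a j b l *: (tens (v m) (x b) * tens (v i) (x a)).
Proof.
transitivity (tens (\sum_a \sum_b R i a m b *: (v a * v b)) (x j * x l)).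
  rewrite -/(tensl _ _) linear_sum; apply: eq_bigr => a _.
  rewrite linear_sum; apply: eq_bigr => b _.
  by rewrite linearZ /= tensM.
rewrite (tens_scale_swap (v_genM i m) (x_genM j l)).
rewrite linear_sum.
apply: eq_bigr => a _; rewrite linear_sum; apply: eq_bigr => b _.
by rewrite linearZ /= tensM.
Qed.

End QuantumRelations.

Unset Implicit Arguments.

Theorem proposition2p7 (k : comNzRingType) (n : nat) (R : tensor2 k n)
    (hR : QYBE R) (lambda : k) (hlambda : exists mu : k, lambda * mu = 1) :
  exists f : {lrmorphism A_alg R ->
                tensor (V_alg (R21 R) lambda) (Vdual_alg R lambda)},
    forall i j : 'I_n,
      f (t_gen R i j) = tens (v_gen (R21 R) lambda i) (x_gen R lambda j).
Proof.
pose e (p : 'I_n * 'I_n) :=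
  tens (v_gen (R21 R) lambda p.1) (x_gen R lambda p.2).
have [|f fE] := @presented_lift _ _ _ _ (@tfree_scalerAr _ _ _) e (A_rel R).
  move=> _ _ [i [j [m [l [-> ->]]]]].
  (* The index maps spell out the monomials of the relation: [t a j * t b l] here, [t m b * t i a]
     on the other side. *)
  apply: etrans (free_eval_quad (@tfree_scalerAr _ _ _) _ _
    (fun a _ => (a, j)) (fun _ b => (b, l))) _.
  apply: etrans (tens_RTT _ _ _ _ _ _) _.
  exact/esym/(free_eval_quad (@tfree_scalerAr _ _ _) _ _
    (fun _ b => (m, b)) (fun a _ => (i, a))).
by exists f => i j; apply: fE (i, j).
Qed.
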